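(* Let $G$ be a finitely generated free group and let $A$ be a finite alphabet. Then the set of sofic minimal subshifts is dense in $\mathcal{S}_{\mathrm{min}}(A^G)$.
   Context: For a finite (non-empty) alphabet $A$ and a countable group $G$, $G$ acts on the compact space $A^G$ by $(g\cdot x)(h)=x(g^{-1}h)$. A subshift is a non-empty, closed, $G$-invariant subset of $A^G$. It is minimal if it has no proper non-empty closed $G$-invariant subset. $\mathcal{S}(A^G)$ is the space of all subshifts of $A^G$ with the Vietoris topology and $\mathcal{S}_{\mathrm{min}}(A^G)$ is the subspace of minimal subshifts, with the subspace topology. A pattern is a function $p\colon F\to A$ with $F\subseteq G$ finite, and $C_p=\{x\in A^G: x|_F=p\}$. A subshift $X\subseteq A^G$ is of finite type (an SFT) if $X=A^G\setminus\bigcup_{p\in P}\bigcup_{g\in G}g\cdot C_p$ for some finite set $P$ of patterns. A subshift $X\subseteq A^G$ is sofic if there are a finite alphabet $B$, an SFT $Y\subseteq B^G$, and a continuous $G$-equivariant surjection $Y\to X$. *)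

(* Defs.v *)
From HB Require Import structures.
From mathcomp Require Import all_boot finmap.
From mathcomp Require Import monoid.
From mathcomp Require Import all_classical.
From mathcomp Require Import topology.

Set Implicit Arguments.
Unset Strict Implicit.
Unset Printing Implicit Defensive.

Local Open Scope classical_set_scope.
Local Open Scope group_scope.

(* Words in the letters s and s^-1 (s \in G): (s, false) stands for s and
   (s, true) for s^-1. *)
Definition word (G : groupType) := seq (G * bool).

Definition letter_val (G : groupType) (l : G * bool) : G :=
  if l.2 then l.1^-1 else l.1.

Definition word_val (G : groupType) (w : word G) : G :=
  \prod_(l <- w) letter_val l.

Definition word_on (G : groupType) (S : set G) (w : word G) : Prop :=
  forall l, l \in w -> S l.1.

Definition reduced (G : groupType) (w : word G) : bool :=
  sorted (fun l m => ~~ ((l.1 == m.1) && (l.2 != m.2))) w.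

Definition freely_generates (G : groupType) (S : set G) : Prop :=
  forall g : G, exists! w : word G,
    [/\ word_on S w, reduced w & word_val w = g].

Definition free_group (G : groupType) : Prop :=
  exists S : set G, freely_generates S.

Definition finitely_generated (G : groupType) : Prop :=
  exists2 S : set G, finite_set S &
    forall g : G, exists2 w : word G, word_on S w & word_val w = g.

(* A^G, with the product of the discrete topologies. *)
Definition full_shift (G : groupType) (A : finType) :=
  {ptws G -> discrete_topology A}.

HB.instance Definition _ (G : groupType) (A : finType) :=
  Topological.on (full_shift G A).

Definition shift (G : groupType) (A : finType) (g : G) (x : full_shift G A) :
  full_shift G A := fun h => x (g^-1 * h).

Definition invariant (G : groupType) (A : finType) (X : set (full_shift G A)) :=
  forall g x, X x -> X (shift g x).

Definition is_subshift (G : groupType) (A : finType)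
    (X : set (full_shift G A)) : Prop :=
  [/\ X !=set0, closed X & invariant X].

Definition is_minimal (G : groupType) (A : finType)
    (X : set (full_shift G A)) : Prop :=
  forall Y, Y !=set0 -> closed Y -> invariant Y -> Y `<=` X -> Y = X.

(* A pattern, i.e. a function F -> A with F a finite subset of G, is a finite
   map; its domain F is domf p. *)
Definition pattern (G : groupType) (A : finType) := {fmap G -> A}.

Definition cylinder (G : groupType) (A : finType) (p : pattern G A) :
  set (full_shift G A) := [set x | forall h : domf p, x (val h) = p h].

Definition is_SFT (G : groupType) (A : finType)
    (X : set (full_shift G A)) : Prop :=
  is_subshift X /\
  exists P : {fset {fmap G -> A}},
    X = ~` \bigcup_(p in [set` P]) \bigcup_(g in [set: G])
             (shift g @` cylinder p).

(* The factor map Y -> X is given by a map on the whole of B^G, only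
   constrained on Y; continuity is that of its restriction to Y. The alphabet B
   is automatically non-empty, because Y is. *)
Definition is_sofic (G : groupType) (A : finType)
    (X : set (full_shift G A)) : Prop :=
  is_subshift X /\
  exists (B : finType) (Y : set (full_shift G B))
         (f : full_shift G B -> full_shift G A),
    [/\ is_SFT Y,
        {within Y, continuous f},
        forall g y, Y y -> f (shift g y) = shift g (f y) &
        f @` Y = X].

Definition subshifts (G : groupType) (A : finType) :=
  set_type [set X : set (full_shift G A) | is_subshift X].

HB.instance Definition _ (G : groupType) (A : finType) :=
  Choice.on (subshifts G A).

Definition subshift_set (G : groupType) (A : finType) (X : subshifts G A) :
  set (full_shift G A) := \val X.

(* The Vietoris topology: it has as a subbase the sets of the subshifts
   contained in U and of the subshifts meeting U, for U open. *)
Definition vietoris_subbase (G : groupType) (A : finType)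
    (i : bool * set (full_shift G A)) : set (subshifts G A) :=
  if i.1 then [set X | subshift_set X `<=` i.2]
  else [set X | subshift_set X `&` i.2 !=set0].

HB.instance Definition _ (G : groupType) (A : finType) :=
  isSubBaseTopological.Build (subshifts G A)
    [set i | open i.2] (@vietoris_subbase G A).

(* A set_type over a topological space carries the subspace topology. *)
Definition minimal_subshifts (G : groupType) (A : finType) :=
  set_type [set X : subshifts G A | is_minimal (subshift_set X)].

HB.instance Definition _ (G : groupType) (A : finType) :=
  Topological.on (minimal_subshifts G A).

Definition minimal_subshift_set (G : groupType) (A : finType)
    (X : minimal_subshifts G A) : set (full_shift G A) :=
  subshift_set (\val X).

(* Main.v *)
From mathcomp Require Import all_boot finmap monoid all_classical topology.
Require Import Defs.

Set Implicit Arguments.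
Unset Strict Implicit.
Unset Printing Implicit Defensive.

Local Open Scope classical_set_scope.
Local Open Scope group_scope.

(** The Cayley graph of a free group over a finite basis is a regular tree, and
a tree can be coloured by a deterministic automaton that works away from an end.

A neighbourhood of a minimal subshift X contains every minimal subshift all of
whose n-ball patterns occur in X, for n large (vietoris_approx). Being contained
in an open set U passes to such approximations by compactness. For meeting U,
minimality gives that the translates of U cover X, so they cover any good
approximation Z as well, and Z, being invariant, meets U itself. It is therefore
enough to find, for each n, a sofic minimal subshift whose n-ball patterns occur
in X (sofic_approximation).

The states of the automaton are the pairs of an n-ball pattern and a letter, the
letter telling in which direction the parent of a vertex lies. A representative
in X is chosen for each pattern; the child in direction u of a vertex with
representative x receives the pattern of x around u, so that the representatives
of adjacent vertices agree, up to translation, on the n-ball. By induction on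
the distance, the configuration obtained by reading the letter at the origin of
each representative coincides on the n-ball around any vertex h with the
representative at h (recode_agree). Hence its n-ball patterns occur in X.

The automaton is restricted to a class of states that is closed under passing to
children and in which each state is a descendant of every other one
(terminal_class). The configurations that obey the automaton everywhere form an
SFT, by locality of the rules. It is non-empty: the automaton, started at one
vertex and run along normal forms, obeys the rules on a cone, which contains
arbitrarily large balls, and compactness applies (tree_shift_neq0). It is
minimal: the states on a ball of radius n are determined by the state of the
n-th ancestor of its centre, and every state of the class occurs in every
configuration (tree_shift_recurrence). Its image under the letter map is the
required sofic minimal subshift. When the basis is empty the group is trivial,
and every subshift is an SFT (sofic_trivial_group). *)

(** * The full shift as a compact space *)

Section Topo.
Variables (G : groupType) (B : finType).

Lemma near_eval (x : full_shift G B) (g : G) :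
  \forall y \near x, y g = x g.
Proof.
have := @proj_continuous G (fun=> discrete_topology B) g x.
by move=> /(_ [set x g]); apply; apply: discrete_set1.
Qed.

Lemma compact_full : compact [set: full_shift G B].
Proof.
have := @tychonoff G (fun=> discrete_topology B) (fun=> setT).
rewrite (_ : [set f | _] = setT); last by apply/seteqP; split.
by apply=> _; apply: finite_compact; apply: finite_finset.
Qed.

Lemma hausdorff_full : hausdorff_space (full_shift G B).
Proof.
apply: (@hausdorff_product G (fun=> discrete_topology B)) => _.
exact: discrete_hausdorff.
Qed.

(** The topology of the full shift is that of pointwise convergence, and in the
discrete alphabet convergence to a letter means eventual equality to it. *)
Lemma cvg_full (F : set_system (full_shift G B)) (x : full_shift G B) :
  Filter F -> (forall g, \forall y \near F, y g = x g) -> F --> x.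
Proof.
move=> FF Fx; apply/cvg_sup => g.
apply/cvg_image.
  by apply/seteqP; split=> // b _; exists (fun=> b).
move=> U Ux; exists ((@^~ g) @^-1` U).
  by apply: filterS (Fx g) => y /= ->; apply: nbhs_singleton Ux.
by apply/seteqP; split=> [_ [y Uy <-] //|b Ub]; exists (fun=> b).
Qed.
End Topo.

(** * Agreement on balls *)

Section Words.
Variables (G : groupType) (L : finType) (lv : L -> G).

Definition ev (w : seq L) : G := \prod_(l <- w) lv l.

Lemma ev_nil : ev [::] = 1. Proof. exact: big_nil. Qed.
Lemma ev_cons l w : ev (l :: w) = lv l * ev w. Proof. exact: big_cons. Qed.
Lemma ev_rcons w l : ev (rcons w l) = ev w * lv l.
Proof. by rewrite /ev big_rcons. Qed.

(** The words of length at most [n] evaluate to the ball of radius [n] around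
the identity in the Cayley graph. *)
Definition agree (B : finType) n (x y : full_shift G B) :=
  forall w, size w <= n -> x (ev w) = y (ev w).

Lemma near_agree (B : finType) n (x : full_shift G B) :
  \forall y \near x, agree n y x.
Proof.
have := filter_forall (nbhs_filter x)
  (fun w : n.-bseq L => near_eval x (ev w)).
by apply: filterS => y xy w wn; have := xy (Bseq wn).
Qed.

Hypothesis generating : forall g, exists w, ev w = g.

(** A sequence of points agreeing with [x] on larger and larger balls converges
to [x], as the balls exhaust the group; it cannot avoid [U] for ever. *)
Lemma nbhs_agree (B : finType) (x : full_shift G B) (U : set (full_shift G B)) :
  nbhs x U -> exists n, forall y, agree n y x -> U y.
Proof.
move=> Ux; apply: contrapT => /forallNP noN.
have /choice[y yP] n : exists y, agree n y x /\ ~ U y.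
  by have /existsNP[y /not_implyP] := noN n; exists y.
have : y @ \oo --> x.
  apply: cvg_full => g; have [w <-] := generating g.
  by exists (size w) => // n /= wn; have [+ _] := yP n; apply.
move=> /(_ _ Ux)[n _ /(_ n (leqnn n))] /=; by have [] := yP n.
Qed.

(** A uniform version of [nbhs_agree] over a compact set: the radii that work
near the points of [K] have a common bound. *)
Lemma compact_agree (B : finType) (K U : set (full_shift G B)) :
  compact K -> open U -> K `<=` U ->
  exists n, forall z x, K x -> agree n z x -> U z.
Proof.
move=> /compact_near_coveringP cK oU KU.
have : \forall n \near \oo, K `<=` (fun x => forall z, agree n z x -> U z).
  apply: cK => x Kx.
  have [n nU] := nbhs_agree (open_nbhs_nbhs (conj oU (KU x Kx))).
  exists ([set y | agree n y x], [set m | n <= m]); first split => /=.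
  - exact: near_agree.
  - by exists n.
  move=> [y m] /= [yx nm] z zy; apply: nU => w wn; rewrite zy ?yx //.
  exact: leq_trans nm.
by move=> [n _ /(_ n (leqnn n)) nU]; exists n => z x Kx; apply: nU.
Qed.

End Words.

Section Shift.
Variables (G : groupType) (B : finType).
Implicit Types (x y : full_shift G B).

Lemma shift_continuous g : continuous (@shift G B g).
Proof.
move=> x.
apply: (cvg_full (fmap_filter (shift g) (nbhs_filter x))) => h.
exact: (near_eval x (g^-1 * h)).
Qed.

Lemma shiftM g h x : shift g (shift h x) = shift (g * h) x.
Proof. by apply/funext => k; rewrite /shift invgM mulgA. Qed.

Lemma shift1 x : shift 1 x = x.
Proof. by apply/funext => k; rewrite /shift invg1 mul1g. Qed.

End Shift.

(** * Neighbourhoods in the space of minimal subshifts *)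

Section Vietoris.
Variables (G : groupType) (L : finType) (lv : L -> G).
Hypothesis generating : forall g, exists w, ev lv w = g.
Variable A : finType.
Implicit Types X Y Z : subshifts G A.

Definition approximates n X Z := forall z, subshift_set Z z ->
  exists2 x, subshift_set X x & agree lv n z x.

Lemma approx_subset X (U : set (full_shift G A)) :
    open U -> subshift_set X `<=` U ->
  \forall n \near \oo, forall Z, approximates n X Z -> subshift_set Z `<=` U.
Proof.
move=> oU XU; have [_ cX _] := set_valP X.
have [|n nU] := compact_agree generating _ oU XU.
  exact: (subclosed_compact cX (@compact_full G A)).
exists n => // m /= nm Z XZ z /XZ[x Xx zx]; apply: nU Xx _ => w wn.
by apply: zx; apply: leq_trans nm.
Qed.

(** Minimality turns this into a statement about containment: the translates of
[U] cover [X], hence also a close approximation of [X], and a subshift that meets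
a translate of [U] meets [U]. *)
Lemma approx_meets X (U : set (full_shift G A)) :
    is_minimal (subshift_set X) -> open U -> subshift_set X `&` U !=set0 ->
  \forall n \near \oo, forall Z, approximates n X Z -> subshift_set Z `&` U !=set0.
Proof.
move=> mX oU [x [Xx Ux]]; have [_ cX iX] := set_valP X.
pose V := \bigcup_g (shift g @^-1` U).
have oV : open V.
  apply: bigcup_open => g _; apply: open_comp => // y _.
  exact: shift_continuous.
have XV : subshift_set X `<=` V.
  move=> y Xy; apply: contrapT => nVy.
  suff XE : subshift_set X `\` V = subshift_set X.
    have [_] : (subshift_set X `\` V) x by rewrite XE.
    by apply; exists 1 => //=; rewrite shift1.
  apply: mX.
  - by exists y.
  - by rewrite setDE; apply: closedI => //; apply: open_closedC.
  - move=> g z [Xz nVz]; split; first exact: iX.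
    by move=> [h _ /=]; rewrite shiftM => Uz; apply: nVz; exists (h * g).
  - by move=> z [].
have := approx_subset oV XV; apply: filterS => n nV Z XZ.
have [[z Zz] _ iZ] := set_valP Z.
have [g _ Ugz] := nV Z XZ z Zz.
by exists (shift g z); split=> //; apply: iZ.
Qed.

Lemma vietoris_approx (O : set (minimal_subshifts G A))
    (X : minimal_subshifts G A) :
  open O -> O X ->
  exists n, forall Z : minimal_subshifts G A,
    approximates n (\val X) (\val Z) -> O Z.
Proof.
move=> [O' oO' <-] /=; have mX := set_valP X.
rewrite set_valE => OX.
have [D' D'b O'E] := oO'.
move: OX; rewrite -O'E /= => -[I D'I IX].
have [D Dopen IE] := D'b _ D'I.
move: IX; rewrite -IE => IX.
have : \forall n \near \oo, forall i, i \in D ->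
    forall Z, approximates n (\val X) Z -> vietoris_subbase i Z.
  apply: (@filter_bigI _ _ D (fun i n => _ )) => i iD.
  have := IX i iD; have /set_mem := Dopen i iD.
  case: i {iD} => [[] U] /=; rewrite /vietoris_subbase /= => oU.
  - exact: approx_subset.
  - exact: approx_meets.
move=> [n _ /(_ n (leqnn n)) nD]; exists n => Z XZ /=.
by exists I => //; rewrite -IE => i iD; apply: nD.
Qed.

End Vietoris.

(** * Subshifts of finite type, minimality and letter-to-letter maps *)

Section Subshifts.
Variables (G : groupType) (B : finType).
Implicit Types (x y z : full_shift G B) (Y : set (full_shift G B)).

(** The forbidden patterns are the finitely many colourings of the window [F]
carried by points that violate the rule [R]. *)
Lemma SFT_of_window Y (F : {fset G}) (R : set (full_shift G B)) :
    is_subshift Y ->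
    (forall y z, (forall h, h \in F -> y h = z h) -> R y -> R z) ->
    Y = [set y | forall g, R (shift g y)] ->
  is_SFT Y.
Proof.
move=> sY RF YE; split=> //.
pose bad (c : {ffun F -> B}) :=
  `[< exists2 y, ~ R y & forall h : F, y (val h) = c h >].
pose pat (c : {ffun F -> B}) : {fmap G -> B} := [fmap h : F => c h]%fmap.
exists [fset pat c | c in [pred c | bad c]]%fset.
rewrite {}YE; apply/seteqP; split=> [y Yy|y nPy g].
  move=> [_ /imfsetP[c /asboolP[z nRz zc] ->] [g _ [x xc xy]]].
  apply: nRz; apply: RF (Yy g^-1) => h hF.
  rewrite -xy shiftM mulVg shift1 (zc [`hF]%fset).
  by have /= -> := xc [`hF]%fset; rewrite ffunE.
apply: contrapT => nR; apply: nPy.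
exists (pat [ffun h : F => shift g y (val h)]).
  apply/imfsetP; eexists; last by [].
  by apply/asboolP; exists (shift g y) => // h; rewrite ffunE.
exists g^-1 => //; exists (shift g y); last by rewrite shiftM mulVg shift1.
by move=> h; rewrite /= !ffunE.
Qed.
End Subshifts.

Section Orbits.
Variables (G : groupType) (L : finType) (lv : L -> G).
Hypothesis generating : forall g, exists w, ev lv w = g.

(** Under this hypothesis the orbit of any point [z] of [Y] is dense in [Y], so
a closed invariant set containing [z] contains [Y]. *)
Lemma minimal_of_recurrence (B : finType) (Y : set (full_shift G B)) :
    (forall y z n, Y y -> Y z -> exists g, agree lv n (shift g y) z) ->
  is_minimal Y.
Proof.
move=> rec Z [z Zz] cZ iZ ZY; apply/seteqP; split=> // y Yy.
rewrite (closure_id Z).1 // => U /(nbhs_agree generating)[n nU].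
have [g gz] := rec z y n (ZY _ Zz) Yy.
by exists (shift g z); split; [apply: iZ|apply: nU].
Qed.
End Orbits.

Definition recode (G : groupType) (B A : finType) (phi : B -> A)
  (y : full_shift G B) : full_shift G A := fun g => phi (y g).

Section Recode.
Variables (G : groupType) (B A : finType) (phi : B -> A).
Local Notation recode := (@recode G B A phi).

Lemma recode_shift g y : recode (shift g y) = shift g (recode y).
Proof. by []. Qed.

Lemma recode_continuous : continuous recode.
Proof.
move=> y; apply: (cvg_full (fmap_filter recode (nbhs_filter y))) => g.
by apply: filterS (near_eval y g) => z; rewrite /recode /= => ->.
Qed.

Lemma recode_subshift Y : is_subshift Y -> is_subshift (recode @` Y).
Proof.
move=> [[y Yy] cY iY]; split.
- by exists (recode y); exists y.
- apply: compact_closed; first exact: hausdorff_full.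
  apply: continuous_compact.
    by apply: continuous_subspaceT; apply: recode_continuous.
  exact: (subclosed_compact cY (@compact_full G B)).
- by move=> g _ [z Yz <-]; exists (shift g z); [apply: iY|].
Qed.

Lemma recode_sofic Y : is_SFT Y -> is_sofic (recode @` Y).
Proof.
move=> sY; split; first exact: recode_subshift sY.1.
exists B, Y, recode; split=> //.
by apply: continuous_subspaceT; apply: recode_continuous.
Qed.

Lemma recode_minimal (L : finType) (lv : L -> G) Y :
    (forall g, exists w, ev lv w = g) ->
    (forall y z n, Y y -> Y z -> exists g, agree lv n (shift g y) z) ->
  is_minimal (recode @` Y).
Proof.
move=> gen rec; apply: (minimal_of_recurrence gen).
move=> _ _ n [y Yy <-] [z Yz <-]; have [g gyz] := rec y z n Yy Yz.
exists g => w wn; rewrite -recode_shift /recode; congr phi; exact: gyz.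
Qed.
End Recode.

(** * Finite bases and normal forms *)

Section FiniteBasis.
Variable G : groupType.
Implicit Types (S : set G) (w : word G) (l : G * bool).

Lemma word_val_cons l w : word_val (l :: w) = letter_val l * word_val w.
Proof. exact: big_cons. Qed.

Lemma word_val_cat w1 w2 : word_val (w1 ++ w2) = word_val w1 * word_val w2.
Proof. exact: big_cat. Qed.

Lemma word_on_cons S l w : word_on S (l :: w) <-> S l.1 /\ word_on S w.
Proof.
split=> [Slw|[Sl Sw] m]; last by rewrite inE => /predU1P[->|/Sw].
by split=> [|m mw]; apply: Slw; rewrite inE ?eqxx ?mw ?orbT.
Qed.

Definition spanned S g := exists2 w, word_on S w & word_val w = g.

Lemma spanned1 S : spanned S 1.
Proof. by exists [::] => //; apply: big_nil. Qed.

Lemma spannedM S g h : spanned S g -> spanned S h -> spanned S (g * h).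
Proof.
move=> [v Sv <-] [w Sw <-]; exists (v ++ w); last exact: word_val_cat.
by move=> l; rewrite mem_cat => /orP[/Sv|/Sw].
Qed.

Lemma spanned_letter S l : S l.1 -> spanned S (letter_val l).
Proof.
move=> Sl; exists [:: l]; first by move=> m; rewrite inE => /eqP ->.
exact: big_seq1.
Qed.

Lemma spannedV S g : spanned S g -> spanned S g^-1.
Proof.
move=> [w + <-]; elim: w => [_|l w IHw /word_on_cons[Sl /IHw Sw]].
  by rewrite /word_val big_nil invg1; apply: spanned1.
rewrite word_val_cons invgM; apply: spannedM => //.
suff -> : (letter_val l)^-1 = letter_val (l.1, ~~ l.2) by apply: spanned_letter.
by case: l {Sl} => s [] /=; rewrite /letter_val ?invgK.
Qed.

Lemma spanned_trans S S' g :
  (forall s, S s -> spanned S' s) -> spanned S g -> spanned S' g.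
Proof.
move=> SS' [w + <-]; elim: w => [_|l w IHw /word_on_cons[Sl /IHw Sw]].
  by rewrite /word_val big_nil; apply: spanned1.
rewrite word_val_cons; apply: spannedM => //.
by case: l Sl => s [] /SS' S's; rewrite /letter_val //=; apply: spannedV.
Qed.

Lemma reduced_cons l w :
  reduced (l :: w) = [&& if w is m :: _ then ~~ ((l.1 == m.1) && (l.2 != m.2))
                         else true & reduced w].
Proof. by case: w. Qed.

(** Free reduction: a letter put in front of a reduced word either cancels the
first letter of that word or leaves the longer word reduced. *)
Lemma spanned_reduced S g : spanned S g ->
  exists w, [/\ word_on S w, reduced w & word_val w = g].
Proof.
move=> [w + <-]; elim: w => [_|l w IHw /word_on_cons[Sl /IHw[v [Sv rv vw]]]].
  by exists [::].
rewrite word_val_cons -{}vw; case: v Sv rv => [|m v] Sv rv.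
  by exists [:: l]; split=> //; [apply/word_on_cons|rewrite word_val_cons].
have [lm|nlm] := boolP ((l.1 == m.1) && (l.2 != m.2)); last first.
  exists (l :: m :: v); split; first exact/word_on_cons.
    by rewrite reduced_cons nlm.
  by rewrite word_val_cons.
exists v; split; first by have /word_on_cons[] := Sv.
  by move: rv; rewrite reduced_cons => /andP[].
rewrite word_val_cons mulgA; case: l m {Sl Sv rv} lm => [s b] [t c] /=.
by move=> /andP[/eqP -> ]; case: b; case: c; rewrite // /letter_val /=
  ?mulgV ?mulVg mul1g.
Qed.

(** The letters of [S] needed to write a finite generating set span the group.
Any further [s] in [S] would be the value of two reduced words, itself and a
word in those letters. *)
Lemma finite_basis : free_group G -> finitely_generated G ->
  exists S : {fset G}, freely_generates [set` S].
Proof.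
move=> [S freeS] [T /finite_fsetP[T' ->] Tgen].
have /choice[w wP] t : exists w, word_on S w /\ word_val w = t.
  by have [w [[Sw _ wt] _]] := freeS t; exists w.
pose S' := [fset l.1 | l in flatten [seq w t | t <- T']]%fset.
exists S'; suff <- : S = [set` S'] by [].
have S'S : [set` S'] `<=` S.
  move=> _ /= /imfsetP[l /flattenP[_ /mapP[t _ ->] lw] ->].
  by have [+ _] := wP t; apply.
apply/seteqP; split=> // s Ss.
have : spanned [set` S'] s.
  apply: (@spanned_trans [set` T']); last by have [v] := Tgen s; exists v.
  move=> t tT; have [_ wt] := wP t; exists (w t) => // l lw.
  by apply/imfsetP; exists l => //; apply/flattenP; exists (w t) => //; apply: map_f.
move=> /spanned_reduced[v [S'v rv vs]].
have [u [_ uniq_u]] := freeS s.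
have uv : u = v by apply: uniq_u; split=> // l /S'v; apply: S'S.
have us : u = [:: (s, false)].
  apply: uniq_u; split=> //; last exact: big_seq1.
  by move=> l; rewrite inE => /eqP ->.
by apply: (S'v (s, false)); rewrite -uv us mem_head.
Qed.
End FiniteBasis.

(** The letters of a finite basis form a finite type, so that the words of bounded
length, and with them the patterns on a ball, do so as well. *)
Section Letters.
Variables (G : groupType) (S : {fset G}).

Definition letter := (S * bool)%type.
Implicit Types (l u v : letter) (w : seq letter).

Definition forget l : G * bool := (val l.1, l.2).
Definition lval l : G := letter_val (forget l).
Definition linv l : letter := (l.1, ~~ l.2).

Lemma linvK : involutive linv.
Proof. by move=> [s b]; rewrite /linv /= negbK. Qed.

Lemma linv_neq l : linv l != l.
Proof. by case: l => s []; rewrite /linv xpair_eqE /= andbF. Qed.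

Lemma lval_linv l : lval (linv l) = (lval l)^-1.
Proof. by case: l => s []; rewrite /lval /letter_val /= ?invgK. Qed.

Definition irred w := sorted (fun l m => m != linv l) w.

Lemma irred_rcons w u :
  irred (rcons w u) =
  irred w && (if w is v :: w' then u != linv (last v w') else true).
Proof. by case: w => [|v w] //=; rewrite /irred /= rcons_path. Qed.

Lemma reduced_forget w : reduced (map forget w) = irred w.
Proof.
rewrite /reduced sorted_map; apply: eq_sorted => l m.
case: l m => [s b] [t c] /=; rewrite /linv xpair_eqE /=.
rewrite val_eqE [s == t]eq_sym; congr (~~ (_ && _)).
by case: b; case: c.
Qed.

Lemma word_val_forget w : word_val (map forget w) = ev lval w.
Proof. by rewrite /word_val big_map. Qed.

Lemma normal_form : freely_generates [set` S] ->
  exists nf : G -> seq letter, [/\ cancel nf (ev lval),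
    forall g, irred (nf g) & forall w, irred w -> nf (ev lval w) = w].
Proof.
move=> freeS.
have forgetI : injective forget by move=> [s b] [t c] [/val_inj -> ->].
have word_onF w : word_on [set` S] (map forget w).
  by move=> _ /mapP[l _ ->]; apply: valP.
have /choice[nf nfP] g : exists w, ev lval w = g /\ irred w.
  have [w [[Sw rw wg] _]] := freeS g.
  suff [v vw] : exists v : seq letter, map forget v = w.
    by exists v; rewrite -word_val_forget vw -reduced_forget vw.
  elim: w Sw {rw wg} => [|[s b] w IHw] Sw; first by exists [::].
  have /word_on_cons[Ss /IHw[v <-]] := Sw.
  by exists (([` Ss]%fset, b) :: v).
exists nf; split=> [g|g|w rw]; [exact: (nfP g).1|exact: (nfP g).2|].
apply: (inj_map forgetI); have [v [_ uniq_v]] := freeS (ev lval w).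
rewrite -(uniq_v (map forget w)); last first.
  by split; rewrite // ?reduced_forget ?word_val_forget.
apply/esym/uniq_v; split; rewrite // ?reduced_forget ?word_val_forget.
  exact: (nfP _).2.
exact: (nfP _).1.
Qed.
End Letters.

(** * Tree automata and their subshifts *)

(** A state from which the fewest states can be reached: any state reached from
it reaches the same states, in particular the initial one. *)
Lemma terminal_class (Q : finType) (e : rel Q) (q0 : Q) :
  exists q, forall p, connect e q p -> connect e p q.
Proof.
pose size_from p := #|[pred r | connect e p r]|.
case: (arg_minnP (P := predT) size_from (i0 := q0)) => // q _ qmin.
exists q => p qp.
have sub : [pred r | connect e p r] \subset [pred r | connect e q r].
  by apply/fintype.subsetP => r /=; apply: connect_trans.
have : [pred r | connect e q r] \subset [pred r | connect e p r].
  by rewrite -(geq_leqif (subset_leqif_card sub)); apply: qmin.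
by move=> /fintype.subsetP; apply; rewrite inE connect0.
Qed.

Section Automaton.
Variables (G : groupType) (S : {fset G}) (Q : finType).
Local Notation letter := (letter S).
Local Notation lv := (@lval G S).
Variables (par : Q -> letter) (step : Q -> letter -> Q).
Hypothesis par_step : forall q u, par (step q u) = linv u.
Variable Q0 : {set Q}.
Implicit Types (y z : full_shift G Q) (u v : letter).

(** Directions other than the one to the parent lead to children, whose states
are given by [step]. *)
Definition child : rel Q :=
  fun q p => [exists u, (u != par q) && (p == step q u)].

(** The last clause says that the parent of [h] does not regard [h] as its own
parent. Without it two neighbours could point at each other, and the state at [h]
would not be determined by that of its parent. *)
Definition lawful y h :=
  [/\ y h \in Q0,
      forall u, u != par (y h) -> y (h * lv u) = step (y h) u &
      linv (par (y h)) != par (y (h * lv (par (y h))))].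

Definition tree_shift := [set y | forall h, lawful y h].

Lemma lawful_local y z h : z h = y h ->
  (forall u, z (h * lv u) = y (h * lv u)) -> lawful y h -> lawful z h.
Proof.
by move=> zy zyu [y1 y2 y3]; split; rewrite zy ?zyu // => u /y2; rewrite zyu.
Qed.

Lemma lawful_shift y g h : lawful (shift g y) h <-> lawful y (g^-1 * h).
Proof.
by rewrite /lawful /shift; split=> -[y1 y2 y3]; split=> //;
   rewrite ?mulgA // -?mulgA // => u /y2; rewrite mulgA.
Qed.

Lemma near_lawless y h : ~ lawful y h -> \forall z \near y, ~ lawful z h.
Proof.
move=> nyh; have := filter_forall (nbhs_filter y)
  (fun u : letter => near_eval y (h * lv u)).
apply: filterS2 (near_eval y h) => z zh zhu lz; apply: nyh.
by apply: lawful_local lz.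
Qed.

Lemma tree_shift_closed : closed tree_shift.
Proof.
rewrite -openC openE => y /existsNP[h /near_lawless].
by apply: filterS => z nzh zY; apply: nzh.
Qed.

Lemma tree_shift_invariant : invariant tree_shift.
Proof. by move=> g y yY h; apply/lawful_shift. Qed.

Lemma tree_shift_SFT : tree_shift !=set0 -> is_SFT tree_shift.
Proof.
move=> Y0.
pose F : {fset G} := (1 |` [fset lv u | u in [pred u : letter | true]])%fset.
apply: (@SFT_of_window _ _ _ F [set y | lawful y 1]).
- split=> //; [exact: tree_shift_closed|exact: tree_shift_invariant].
- move=> y z yz /=; apply: lawful_local.
    by rewrite yz // !inE eqxx.
  move=> u; rewrite mul1g yz // !inE; apply/orP; right.
  by apply/imfsetP; exists u.
- apply/seteqP; split=> [y yY g|y yY h] /=; first exact/lawful_shift.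
  by have /lawful_shift := yY h^-1; rewrite invgK mulg1.
Qed.

Hypothesis Q0_child : forall q p, q \in Q0 -> child q p -> p \in Q0.
Hypothesis Q0_connect : forall q p, q \in Q0 -> p \in Q0 -> connect child q p.

Lemma childP q u : u != par q -> child q (step q u).
Proof. by move=> uq; apply/existsP; exists u; rewrite uq eqxx. Qed.

(** A path in the graph of states can be followed downwards in [y], starting
anywhere. *)
Lemma occurs y q : tree_shift y -> q \in Q0 -> exists h, y h = q.
Proof.
move=> yY q0; have [yg _ _] := yY 1.
have /connectP[p yp ->] := Q0_connect yg q0.
elim: p (1 : G) yp {yg} => [|r p IHp] g /=; first by exists g.
move=> /andP[/existsP[u /andP[uy /eqP ->]]].
by have [_ <- // _] := yY g; apply: IHp.
Qed.

(** Two configurations are compared after the translation by [g], the family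
tree being that of [z]. *)
Section Recurrence.
Variables y z : full_shift G Q.
Hypotheses (yY : tree_shift y) (zY : tree_shift z).

Definition parent k := k * lv (par (z k)).
Definition anc j k := iter j parent k.
Variable g : G.

(** Coincidence along the chain of the first [j] ancestors of [k]. This is the
form in which coincidence propagates to neighbours: a step to the parent or to a
child costs at most one generation ([good_step]). *)
Definition good j k := forall i, i <= j -> y (g * anc i k) = z (anc i k).

Lemma parentK k u : u != par (z k) -> parent (k * lv u) = k.
Proof.
move=> uk; have [_ /(_ _ uk) zu _] := zY k.
by rewrite /parent zu par_step lval_linv mulgK.
Qed.

(** Coincidence spreads to all children of a vertex, since the same automaton
acts in both configurations. *)
Lemma same_child k u :
  y (g * k) = z k -> u != par (z k) -> y (g * (k * lv u)) = z (k * lv u).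
Proof.
move=> yzk uk; have [_ /(_ u) ys _] := yY (g * k); have [_ /(_ u) zs _] := zY k.
by rewrite mulgA ys ?zs ?yzk.
Qed.

Lemma same_parent k : y (g * parent k) = z (parent k) -> y (g * k) = z k.
Proof.
move=> yzp; have [_ _ zk] := zY k.
by have := same_child yzp zk; rewrite /parent lval_linv mulgK.
Qed.

Lemma good_anc j k : y (g * anc j k) = z (anc j k) -> good j k.
Proof.
elim: j => [|j IHj] yzj i; first by rewrite leqn0 => /eqP ->.
rewrite leq_eqVlt => /predU1P[->//|]; apply: IHj.
exact: same_parent.
Qed.

Lemma good_step j k u : good j.+1 k -> good j (k * lv u).
Proof.
move=> gk; have [->|uk] := eqVneq u (par (z k)) => i ij.
  have -> : anc i (k * lv (par (z k))) = anc i.+1 k by rewrite /anc iterSr.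
  exact: gk.
case: i ij => [|i] ij; first exact: same_child (gk 0 _) uk.
rewrite /anc iterSr parentK //; apply: gk.
by rewrite (leq_trans (ltnW ij)).
Qed.

Lemma good_ball j k w : good j k -> size w <= j ->
  y (g * (k * ev lv w)) = z (k * ev lv w).
Proof.
elim: w j k => [|u w IHw] j k gk; first by rewrite ev_nil mulg1 => _; apply: (gk 0).
case: j gk => // j gk wj; rewrite ev_cons [k * _]mulgA.
by apply: (IHw j) wj; apply: good_step.
Qed.
End Recurrence.

(** The translation takes the [n]-th ancestor of the origin in [z] to a vertex
of [y] with the same state. Coincidence descends from there to the origin, and
spreads over the ball of radius [n]. *)
Lemma tree_shift_recurrence y z n :
  tree_shift y -> tree_shift z -> exists g, agree lv n (shift g y) z.
Proof.
move=> yY zY; pose a := anc z n 1.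
have [za _ _] := zY a; have [h ha] := occurs yY za.
exists (a / h) => w wn; rewrite /shift invgF.
have gn : good y z (h / a) n 1 by apply: good_anc => //; rewrite -mulgA mulVg mulg1.
by have := good_ball yY zY gn wn; rewrite mul1g.
Qed.

Variable nf : G -> seq letter.
Hypotheses (nfK : cancel nf (ev lv)) (nf_irred : forall g, irred (nf g)).
Hypothesis nf_ev : forall w, irred w -> nf (ev lv w) = w.

Lemma nf_mul g u : (if nf g is v :: w then u != linv (last v w) else true) ->
  nf (g * lv u) = rcons (nf g) u.
Proof.
move=> gu; rewrite -{1}[g]nfK -ev_rcons nf_ev // irred_rcons nf_irred.
by case: (nf g) gu.
Qed.

Lemma nf_mulV g w v : nf g = rcons w v -> nf (g * lv (linv v)) = w.
Proof.
move=> gw; have := nf_irred g; rewrite gw irred_rcons => /andP[wi _].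
by rewrite -[g]nfK gw ev_rcons lval_linv mulgK nf_ev.
Qed.

(** Multiplication by a letter changes a normal form at its end only, by one
letter, so a long normal form keeps its head. *)
Lemma nf_head (g : G) (v : letter) (m : nat) k :
  (exists2 w, nf g = v :: w & size k + m <= size w) ->
  exists2 w, nf (g * ev lv k) = v :: w & m <= size w.
Proof.
elim: k g => [|u k IHk] g; first by rewrite ev_nil mulg1.
move=> [w gw kw]; rewrite ev_cons mulgA; apply: IHk.
have [ul|ul] := eqVneq u (linv (last v w)); last first.
  exists (rcons w u); first by rewrite nf_mul gw.
  by rewrite size_rcons ltnW // ltnS ltnW.
case/lastP: w gw kw ul => [|w l] gw kw ul //.
exists w; last by move: kw; rewrite size_rcons addSn ltnS.
by rewrite ul last_rcons; apply: (@nf_mulV _ (v :: w)).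
Qed.

(** The automaton is run along normal forms, from state [q] at the origin. The
rules hold at each vertex whose normal form starts in a direction other than
[par q], that is, away from the origin and from the branch on the side of the
supposed parent of the origin. *)
Section Cone.
Variables (q : Q) (q0 : q \in Q0).
Definition cone : full_shift G Q := fun g => foldl step q (nf g).

Lemma foldl_step w u : foldl step q (rcons w u) = step (foldl step q w) u.
Proof. by rewrite -cats1 foldl_cat. Qed.

Lemma cone_step g u : u != par (cone g) -> cone (g * lv u) = step (cone g) u.
Proof.
move=> ug; rewrite /cone nf_mul ?foldl_step //.
move: ug; rewrite /cone; case/lastP: (nf g) => // w v.
rewrite foldl_step par_step; case: w => //= x w.
by rewrite last_rcons.
Qed.

Lemma foldl_Q0 v w : v != par q -> irred (v :: w) -> foldl step q (v :: w) \in Q0.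
Proof.
move=> vq; elim/last_ind: w => [_|w u IHw].
  exact: Q0_child q0 (childP vq).
rewrite -rcons_cons irred_rcons foldl_step => /andP[/IHw vw uw].
apply: Q0_child vw (childP _); move: uw.
case/lastP: w {IHw} => [|w x]; first by rewrite /= par_step.
by rewrite -rcons_cons foldl_step par_step /= last_rcons.
Qed.

Lemma cone_lawful g v w : nf g = v :: w -> v != par q -> lawful cone g.
Proof.
move=> gvw vq; split; [|exact: cone_step|].
  by rewrite /cone gvw foldl_Q0 // -gvw.
move: gvw; case/lastP: w => [|w u] gvw.
  have gv : nf g = rcons [::] v by rewrite gvw.
  by rewrite /cone gv /= par_step linvK (nf_mulV gv).
have gw : nf g = rcons (v :: w) u by rewrite gvw.
have -> : par (cone g) = linv u by rewrite /cone gw foldl_step par_step.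
rewrite linvK /cone (nf_mulV gw).
have := nf_irred g; rewrite gw irred_rcons => /andP[_].
case/lastP: w {gvw gw} => [|w x]; first by rewrite /= par_step.
by rewrite -rcons_cons foldl_step par_step /= last_rcons.
Qed.
End Cone.

(** If no configuration were lawful everywhere, compactness would give a radius
[n] such that every configuration is lawless somewhere in the ball of radius [n].
But [cone q] is lawful on a translate of that ball that lies in the cone. *)
Lemma tree_shift_neq0 : Q0 != finset.set0 -> tree_shift !=set0.
Proof.
move=> /set0Pn[q q0]; apply: contrapT => /forallNP noY.
have /compact_near_coveringP cQ := @compact_full G Q.
have [|n _] := cQ nat \oo
  (fun n y => exists2 w, size w <= n & ~ lawful y (ev lv w)) _.
  move=> y _; have /existsNP[h nyh] := noY y.
  exists ([set z | ~ lawful z h], [set n | size (nf h) <= n]).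
    by split; [exact: near_lawless|exists (size (nf h))].
  by move=> [z n] [/= nzh hn]; exists (nf h); rewrite ?nfK.
move=> /(_ n (leqnn n)) bad.
(* The power of [v] of exponent [n.+1] is the centre of a ball of radius [n]
   whose elements all have a normal form starting with [v]. *)
pose v := linv (par q); have vq : v != par q by apply: linv_neq.
pose g := ev lv (nseq n.+1 v).
have [w wn] := bad (shift g^-1 (cone q)) I; apply.
apply/lawful_shift; rewrite invgK.
have vi : irred (nseq n.+1 v).
  rewrite /irred /=; elim: n {bad g wn} => //= n ->.
  by rewrite andbT eq_sym linv_neq.
have [|k gk _] := @nf_head g v 0 w.
  by exists (nseq n v); rewrite ?nf_ev // addn0 size_nseq.
exact: cone_lawful gk vq.
Qed.
End Automaton.

(** * Sofic approximations and density *)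

Section Approximation.
Variables (G : groupType) (S : {fset G}).
Hypothesis freeS : freely_generates [set` S].
Variable A : finType.
Local Notation lv := (@lval G S).

Lemma letters_generate g : exists w, ev lv w = g.
Proof. by have [nf [nfK _ _]] := normal_form freeS; exists (nf g). Qed.

Section Label.
Variables (Q : finType) (par : Q -> letter S) (step : Q -> letter S -> Q).
Variables (Q0 : {set Q}) (n : nat) (pt : Q -> full_shift G A).
Hypothesis pt_step :
  forall q u, agree lv n (pt (step q u)) (shift (lv u)^-1 (pt q)).

(** Adjacent vertices carry points that are translates of each other up to
radius [n]: of the two ends of an edge one is the parent of the other, and
[pt_step] applies there. A word of length [n] can therefore be followed letter by
letter, the points visited agreeing on what remains of the ball. *)
Lemma recode_agree y w h : tree_shift par step Q0 y -> size w <= n ->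
  recode (fun q => pt q 1) y (h * ev lv w) = pt (y h) (ev lv w).
Proof.
move=> yY; elim: w h => [|u w IHw] h wn; first by rewrite ev_nil mulg1.
rewrite ev_cons mulgA IHw ?(ltnW wn) //.
have [_ yh par_h] := yY h.
have [uh|uh] := eqVneq u (par (y h)); last first.
  by rewrite yh // pt_step ?(ltnW wn) // /shift invgK.
have [_ /(_ (linv u)) yhu _] := yY (h * lv u).
rewrite -uh in par_h; move: (yhu par_h); rewrite lval_linv mulgK => ->.
by rewrite -(ev_cons lv) pt_step // ev_cons /shift invgK lval_linv mulKg.
Qed.
End Label.

(** The states pair an [n]-ball pattern with the direction of the parent. The
existence of a letter provides an initial state. *)
Lemma sofic_approximation (X : set (full_shift G A)) (n : nat) :
    is_subshift X -> (0 < #|{: letter S}|)%N ->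
  exists Z, [/\ is_sofic Z, is_minimal Z &
    forall z, Z z -> exists2 x, X x & agree lv n z x].
Proof.
move=> [[x0 Xx0] _ iX] /card_gt0P[l0 _].
have [nf [nfK nf_irred nf_ev]] := normal_form freeS.
pose code (x : full_shift G A) : {ffun n.-bseq (letter S) -> A} :=
  [ffun w => x (ev lv (val w))].
(* A pattern that does not occur in [X] is represented by an arbitrary point of
   [X], which makes all representatives points of [X] and [step] total. *)
have /choice[rep repP] c : exists x, X x /\
    forall x', X x' -> code x' = c -> agree lv n x x'.
  have [[x Xx xc]|noc] := pselect (exists2 x, X x & code x = c); last first.
    by exists x0; split=> // x Xx xc; case: noc; exists x.
  exists x; split=> // x' _ xc' w wn; move: xc; rewrite -xc' => /ffunP.
  by move=> /(_ (Bseq wn)); rewrite !ffunE.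
pose Q := ({ffun n.-bseq (letter S) -> A} * letter S)%type.
pose par (q : Q) := q.2.
pose step (q : Q) u : Q := (code (shift (lv u)^-1 (rep q.1)), linv u).
have par_step q u : par (step q u) = linv u by [].
have pt_step (q : Q) u :
    agree lv n (rep (step q u).1) (shift (lv u)^-1 (rep q.1)).
  by have [_] := repP (step q u).1; apply=> //; apply: iX; apply: (repP q.1).1.
have [q0 q0P] := terminal_class (child par step) (code x0, l0).
pose Q0 := [set q | connect (child par step) q0 q]%SET.
have q0Q0 : q0 \in Q0 by rewrite inE connect0.
have Q0_child q p : q \in Q0 -> child par step q p -> p \in Q0.
  by rewrite !inE => q0q qp; apply: connect_trans q0q (connect1 qp).
have Q0_connect q p : q \in Q0 -> p \in Q0 -> connect (child par step) q p.
  by rewrite !inE => /q0P qq0; apply: connect_trans.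
have Y0 : tree_shift par step Q0 !=set0.
  apply: (tree_shift_neq0 par_step Q0_child nfK nf_irred nf_ev).
  by apply/set0Pn; exists q0.
exists (recode (fun q : Q => rep q.1 1) @` tree_shift par step Q0); split.
- by apply: recode_sofic; apply: tree_shift_SFT.
- apply: recode_minimal letters_generate _ => y z m.
  exact: tree_shift_recurrence.
- move=> _ [y yY <-]; exists (rep (y 1).1); first exact: (repP _).1.
  move=> w wn; rewrite -[ev lv w]mul1g.
  by rewrite (recode_agree (pt := fun q : Q => rep q.1) pt_step 1 yY wn) mul1g.
Qed.
End Approximation.

(** Over the trivial group a configuration is a single letter, so membership in
[X] is itself a rule with window the identity. *)
Lemma sofic_trivial_group (G : groupType) (A : finType)
    (X : set (full_shift G A)) :
  (forall g : G, g = 1) -> is_subshift X -> is_sofic X.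
Proof.
move=> G1 sX; have [_ _ iX] := sX.
rewrite -(image_id X); apply: (@recode_sofic _ _ _ id).
apply: (@SFT_of_window _ _ _ [fset 1]%fset X) => //.
- move=> y z yz; suff -> : y = z by [].
  by apply/funext => g; rewrite [g]G1 yz // inE.
- apply/seteqP; split=> [y Xy g|y /(_ 1)]; first exact: iX.
  by rewrite shift1.
Qed.

Theorem theorem1p2 (G : groupType) (A : finType)
    (G_free : free_group G) (G_fg : finitely_generated G)
    (A_nonempty : (0 < #|A|)%N) :
  dense [set X : minimal_subshifts G A | is_sofic (minimal_subshift_set X)].
Proof.
move=> O [X OX] oO; have [S freeS] := finite_basis G_free G_fg.
have gen := letters_generate freeS.
have sX := set_valP (\val X).
have [L0|] := posnP #|{: letter S}|.
  exists X; split=> //; apply: sofic_trivial_group sX => g.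
  have [[|l w] <-] := gen g; first exact: ev_nil.
  by have := card0_eq L0 l; rewrite inE.
move=> L0; have [n nO] := vietoris_approx gen oO OX.
have [Z [sofZ mZ ZX]] := sofic_approximation freeS n sX L0.
have [sZ _] := sofZ.
pose Z1 : subshifts G A := SigSub (mem_set sZ).
have mZ1 : Z1 \in [set Y : subshifts G A | is_minimal (subshift_set Y)].
  exact: mem_set.
exists (exist _ Z1 mZ1 : minimal_subshifts G A); split=> //; exact: nO.
Qed.
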